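(* Let $G$ be a finite group, let $c>0$, let $n$ be a positive integer, and let $f:G\to M_n(\mathbb{C})$ be a function such that $\|f(x)\|_{\mathrm{op}}\leq 1$ for every $x\in G$ and $\|f\|_{U^2}^4\geq cn$. Then there exist an integer $m\in\left[\frac{cn}{2-c},\frac{(2-c)n}{c}\right]$, $n\times m$ partial unitary matrices $U$ and $V$, and a unitary representation $P:G\to U(m)$ such that \[\left|\mathbb{E}_x\langle f(x), VP(x)U^*\rangle\right|\geq \tau(c)^4 m,\] where $\tau(c)=\max\{(c/2)^{1/2},(c/(2-c))^2\}$.
   Context: $\mathbb{E}_x$ denotes the average over $x\in G$. $\|\cdot\|_{\mathrm{op}}$ is the operator norm, and $\langle A,B\rangle=\mathrm{tr}(AB^* )$. For $f:G\to M_n(\mathbb{C})$, the $U^2$ norm is defined by \[\|f\|_{U^2}^4=\mathbb{E}_{xy^{-1}zw^{-1}=e}\,\mathrm{tr}(f(x)f(y)^*f(z)f(w)^* ),\] the average being over all quadruples $(x,y,z,w)\in G^4$ with $xy^{-1}zw^{-1}=e$. An $n\times m$ complex matrix is called a partial unitary matrix if its rows are orthonormal when $n\leq m$ and its columns are orthonormal when $n\geq m$ (equivalently, all its $\min\{n,m\}$ singular values equal $1$). $U(m)$ is the group of $m\times m$ unitary matrices; a unitary representation is a homomorphism into $U(m)$. *)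

(* Defs.v *)
From mathcomp Require Import all_boot all_order all_algebra all_fingroup.
From mathcomp Require Import mxrepresentation complex.
From mathcomp Require Import boolp classical_sets reals.

Set Implicit Arguments.
Unset Strict Implicit.
Unset Printing Implicit Defensive.

Import Order.TTheory GRing.Theory Num.Theory.
Local Open Scope ring_scope.
Local Open Scope complex_scope.
Local Open Scope sesquilinear_scope.

(* The complex numbers are [R[i]] over an arbitrary [R : realType]. Its order
   is partial: [x <= y] means that [x] and [y] have the same imaginary part
   and that [Re x <= Re y]; its norm [`|x|] is the complex number [|x| + 0i]. *)

Section Defs.

Variable R : realType.
Local Notation C := R[i].

Definition average (T : finType) (A : {set T}) (F : T -> C) : C :=
  (#|A|%:R)^-1 * \sum_(t in A) F t.

Definition mxinner (n m : nat) (A B : 'M[C]_(n, m)) : C := \tr (A *m B^t*).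

Definition vnorm (n : nat) (v : 'cV[C]_n) : R :=
  Num.sqrt (\sum_i ComplexField.Normc.normc (v i 0) ^+ 2).

Definition opnorm (n m : nat) (A : 'M[C]_(n, m)) : R :=
  sup [set vnorm (A *m v) | v in [set v : 'cV[C]_m | vnorm v <= 1]]%classic.

Definition quads (G : finGroupType) : {set G * G * G * G} :=
  [set q | let: (x, y, z, w) := q in (x * y^-1 * z * w^-1 == 1)%g].

(* [4.-root] of a nonnegative real element of [R[i]] is its nonnegative real
   fourth root; in general [4.-root a ^+ 4 = a]. *)
Definition U2norm (G : finGroupType) (n : nat) (f : G -> 'M[C]_n) : C :=
  4.-root (average (quads G) (fun q => let: (x, y, z, w) := q in
    \tr (f x *m (f y)^t* *m f z *m (f w)^t*))).

(* For a rectangular [M], [M \is unitarymx] only says [M *m M^t* = 1%:M],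
   i.e. that the rows of [M] are orthonormal. *)
Definition partial_unitary (n m : nat) (M : 'M[C]_(n, m)) : Prop :=
  ((n <= m)%N -> M \is unitarymx) /\ ((m <= n)%N -> M^t* \is unitarymx).

Definition unitary_repr (G : finGroupType) (m : nat)
    (P : mx_representation C [set: G] m) : Prop :=
  forall x : G, P x \is unitarymx.

Definition tau (c : R) : R := Num.max (Num.sqrt (c / 2)) ((c / (2 - c)) ^+ 2).

End Defs.

(* Main.v *)
(* Convolution by f, (T phi)(x) = E_y f(x y^-1) phi(y), acts on functions G -> C^n
   and commutes with the right translations R_g.  It is a contraction with
   |T|_HS^2 <= n, and |T^* T|_HS^2 = |f|_{U^2}^4 >= c n.  Let W be the sum of the
   eigenspaces of H = T^* T with eigenvalue at least c/2; it is R-invariant, which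
   gives a unitary representation P on W, and the two bounds on the
   eigenvalues confine m = dim W to the required interval.  Evaluating at the
   identity turns T|W and H|W into n x m matrices V_0 and U_0.  Both are
   contractions, since V_0 V_0^* <= E_x f(x) f(x)^* and U_0 = E_x f(x)^* V_0 P(x),
   and E_x <f(x), V_0 P(x) U_0^*> = |U_0|_HS^2 is the sum of the squares of the
   eigenvalues of H on W, which is at least tau(c)^4 m.  As the form
   E_x <f(x), V P(x) U^*> is sesquilinear, U_0 and V_0 can then be replaced
   one after the other by partial unitary matrices: by the singular value
   decomposition, a linear functional on contractions is largest in modulus on those. *)
Require Import Defs.
From mathcomp Require Import all_boot all_order all_algebra all_fingroup.
From mathcomp Require Import mxrepresentation complex.
From mathcomp Require Import reals.
From mathcomp Require Import ring lra.

Set Implicit Arguments.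
Unset Strict Implicit.
Unset Printing Implicit Defensive.

Import Order.TTheory GRing.Theory Num.Theory.
Local Open Scope ring_scope.
Local Open Scope sesquilinear_scope.

(** * Squared Hilbert-Schmidt norm, contractions, unitary diagonalization *)

Section Contractions.

Variable C : numClosedFieldType.

Lemma trmxC_mul m n p (A : 'M[C]_(m, n)) (B : 'M_(n, p)) :
  (A *m B)^t* = B^t* *m A^t*.
Proof. by rewrite trmx_mul map_mxM. Qed.

Lemma trmxCB m n (A B : 'M[C]_(m, n)) : (A - B)^t* = A^t* - B^t*.
Proof. by rewrite raddfB map_mxB. Qed.

Lemma trmxCZ m n a (A : 'M[C]_(m, n)) : (a *: A)^t* = a^* *: A^t*.
Proof. by rewrite linearZ map_mxZ. Qed.

Lemma trmxC_sum m n I (r : seq I) (P : pred I) (F : I -> 'M[C]_(m, n)) :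
  (\sum_(i <- r | P i) F i)^t* = \sum_(i <- r | P i) (F i)^t*.
Proof. by rewrite !raddf_sum /=. Qed.

Lemma trmxC1 n : (1%:M : 'M[C]_n)^t* = 1%:M.
Proof. by rewrite trmx1 map_mx1. Qed.

Lemma trmxC_diag n (d : 'rV[C]_n) : (diag_mx d)^t* = diag_mx (map_mx Num.conj d).
Proof. by rewrite tr_diag_mx map_diag_mx. Qed.

Lemma mxtraceC n (A : 'M[C]_n) : \tr (A^t*) = (\tr A)^*.
Proof. by rewrite /mxtrace rmorph_sum; apply: eq_bigr => i _; rewrite !mxE. Qed.

(** The squared Hilbert-Schmidt norm; on vectors it is the squared Euclidean length, so estimates
    need no square roots. *)
Definition hs m n (X : 'M[C]_(m, n)) : C := \tr (X *m X^t*).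

Lemma hsE m n (X : 'M[C]_(m, n)) : hs X = \sum_i \sum_j `|X i j| ^+ 2.
Proof.
apply: eq_bigr => i _; rewrite mxE; apply: eq_bigr => j _.
by rewrite !mxE normCK.
Qed.

Lemma hs_ge0 m n (X : 'M[C]_(m, n)) : 0 <= hs X.
Proof.
rewrite hsE; apply: sumr_ge0 => i _; apply: sumr_ge0 => j _.
by rewrite exprn_ge0.
Qed.

Lemma hs_trmxC m n (X : 'M[C]_(m, n)) : hs (X^t*) = hs X.
Proof. by rewrite /hs trmxCK mxtrace_mulC. Qed.

Lemma hsZ m n a (X : 'M[C]_(m, n)) : hs (a *: X) = `|a| ^+ 2 * hs X.
Proof.
by rewrite /hs trmxCZ -scalemxAl -scalemxAr scalerA linearZ normCK.
Qed.

Lemma hsB m n (X Y : 'M[C]_(m, n)) :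
  hs (X - Y) = hs X + hs Y - \tr (X *m Y^t*) - \tr (Y *m X^t*).
Proof.
by rewrite /hs trmxCB mulmxBl !mulmxBr !raddfB /=; ring.
Qed.

(** Cauchy-Schwarz, from nonnegativity of the sum over all pairs of [hs (X s - X t)], which expands
    to twice the difference of the two sides. *)
Lemma hs_sum_le (T : finType) m n (X : T -> 'M[C]_(m, n)) :
  hs (\sum_t X t) <= #|T|%:R * \sum_t hs (X t).
Proof.
set S := \sum_t X t.
have pairs Y : \sum_t \tr (Y *m (X t)^t*) = \tr (Y *m S^t*).
  by rewrite trmxC_sum mulmx_sumr raddf_sum.
have pairs' Y : \sum_t \tr (X t *m Y^t*) = \tr (S *m Y^t*).
  by rewrite mulmx_suml raddf_sum.
have : 0 <= \sum_s \sum_t hs (X s - X t).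
  by apply: sumr_ge0 => s _; apply: sumr_ge0 => t _; apply: hs_ge0.
under eq_bigr => s _.
  under eq_bigr do rewrite hsB.
  rewrite !sumrB big_split /= sumr_const pairs pairs'; over.
rewrite !sumrB big_split /= sumr_const pairs pairs' -sumrMnl -/(hs S).
rewrite -mulr2n -addrA -opprD -mulr2n -mulrnBl pmulrn_lge0 // subr_ge0.
by rewrite mulr_natl sumrMnl.
Qed.

Lemma hs_col m n (X : 'M[C]_(m, n)) : hs X = \sum_j hs (col j X).
Proof.
rewrite hsE exchange_big; apply: eq_bigr => j _.
by rewrite hsE; apply: eq_bigr => i _; rewrite big_ord1 mxE.
Qed.

Definition contraction m n (A : 'M[C]_(m, n)) :=
  forall v : 'cV[C]_n, hs (A *m v) <= hs v.

Lemma contraction_hs m n p (A : 'M[C]_(m, n)) (X : 'M_(n, p)) :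
  contraction A -> hs (A *m X) <= hs X.
Proof.
move=> cA; rewrite !hs_col; apply: ler_sum => j _.
by rewrite colE -mulmxA -colE; apply: cA.
Qed.

Lemma contraction_trmxC m n (A : 'M[C]_(m, n)) :
  contraction A -> contraction (A^t*).
Proof.
(* Expand 0 <= |v - A A^* v|^2. *)
move=> cA v; set w := A^t* *m v.
have := hs_ge0 (v - A *m w); rewrite hsB.
have -> : \tr (v *m (A *m w)^t*) = hs w.
  by rewrite mxtrace_mulC trmxC_mul -mulmxA mxtrace_mulC.
have -> : \tr (A *m w *m v^t*) = hs w.
  by rewrite -mulmxA mxtrace_mulC /hs trmxC_mul trmxCK mulmxA.
move=> h; have := le_trans h (lerD (lerD (lerD (lexx _) (cA w)) (lexx _)) (lexx _)).
by rewrite addrK subr_ge0.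
Qed.

Lemma contractionM m n p (A : 'M[C]_(m, n)) (B : 'M_(n, p)) :
  contraction A -> contraction B -> contraction (A *m B).
Proof. by move=> cA cB v; rewrite -mulmxA (le_trans (cA _)). Qed.

Lemma contraction_isometry m n (A : 'M[C]_(m, n)) :
  A^t* *m A = 1%:M -> contraction A.
Proof.
by move=> A1 v; rewrite -!(hs_trmxC (_ *m _)) /hs trmxCK trmxC_mul mulmxA
  -(mulmxA _ _ A) A1 mulmx1 -[X in _ <= X]hs_trmxC /hs trmxCK.
Qed.

Lemma contraction_average (T : finType) m n (A : T -> 'M[C]_(m, n)) :
  (forall t, contraction (A t)) ->
  contraction ((#|T|%:R)^-1 *: \sum_t A t).
Proof.
(* For empty [T] the inverse of 0 is 0, so the average is the zero matrix. *)
move=> cA v; have [T0|Tgt0] := posnP #|T|.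
  by rewrite T0 invr0 scale0r mul0mx /hs mul0mx mxtrace0 hs_ge0.
have TR : (0 : C) < #|T|%:R by rewrite ltr0n.
rewrite -scalemxAl hsZ mulmx_suml ger0_norm ?invr_ge0 ?ler0n //.
rewrite exprVn ler_pdivrMl ?exprn_gt0 //.
apply: le_trans (hs_sum_le _) _; rewrite expr2 -mulrA ler_pM2l //.
rewrite mulr_natl -sumr_const; apply: ler_sum => t _; exact: cA.
Qed.

Lemma hermitian_spectral n (A : 'M[C]_n) : A^t* = A ->
  exists (Q : 'M[C]_n) (d : 'rV_n),
    Q \is unitarymx /\ A = Q^t* *m diag_mx d *m Q.
Proof.
move=> hA; have /orthomx_spectralP AE : A \is normalmx.
  by apply/normalmxP; rewrite hA.
exists (spectralmx A), (spectral_diag A).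
by rewrite -invmx_unitary ?spectral_unitarymx.
Qed.

Lemma unitarymxPV n (Q : 'M[C]_n) : Q \is unitarymx -> Q^t* *m Q = 1%:M.
Proof.
by move=> uQ; have := trmxC_unitary Q; rewrite uQ => /unitarymxP; rewrite trmxCK.
Qed.

End Contractions.

(** * Singular values and rounding contractions to partial unitary matrices *)

Section SingularValues.

Variable C : numClosedFieldType.

Lemma mul_trmxCE m n p (A : 'M[C]_(m, n)) (B : 'M_(p, n)) i j :
  (A *m B^t*) i j = (row i A *m (row j B)^t*) 0 0.
Proof. by rewrite !mxE; apply: eq_bigr => k _; rewrite !mxE. Qed.

Lemma hs_row n (v : 'rV[C]_n) : (v *m v^t*) 0 0 = hs v.
Proof. by rewrite /hs /mxtrace big_ord1. Qed.

Lemma hs_gt0 m n (X : 'M[C]_(m, n)) : (0 < hs X) = (X != 0).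
Proof.
apply/idP/idP => [|X0]; first by apply: contraTneq => ->; rewrite /hs mul0mx mxtrace0 ltxx.
rewrite lt_def hs_ge0 andbT; apply: contra_neq X0 => hX0.
apply/matrixP => i j; rewrite mxE; apply/eqP.
have sum_ge0 k : 0 <= \sum_l `|X k l| ^+ 2 by apply: sumr_ge0 => l _; rewrite exprn_ge0.
move: hX0; rewrite hsE => /eqP; rewrite psumr_eq0 // => /allP /(_ i).
rewrite mem_index_enum => /(_ isT); rewrite psumr_eq0 => [/allP /(_ j)|l _].
  by rewrite mem_index_enum => /(_ isT); rewrite sqrf_eq0 normr_eq0.
by rewrite exprn_ge0.
Qed.

(** If no row vanishes, normalize the rows. Otherwise replace a zero row by a nonzero vector
    orthogonal to all rows, induct on the number of zero rows, and give that row the coefficient 0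
    at the end. *)
Lemma orthogonal_rows_complete n m (B : 'M[C]_(n, m)) : (n <= m)%N ->
  (forall i j, i != j -> (B *m B^t*) i j = 0) ->
  exists2 Y : 'M[C]_(n, m), Y \is unitarymx &
    exists s : 'rV_n, B = diag_mx s *m Y.
Proof.
move=> le_nm; have [k] := ubnP #|[pred i | row i B == 0]|.
elim: k B => // k IHk B; rewrite ltnS => ltBk orthB.
have [i Bi0|Bn0] := pickP [pred i | row i B == 0]; last first.
  pose s : 'rV[C]_n := \row_i sqrtC (hs (row i B)).
  have s_gt0 i : 0 < s 0 i by rewrite mxE sqrtC_gt0 hs_gt0; exact: (negbT (Bn0 i)).
  exists (diag_mx (\row_i (s 0 i)^-1) *m B).
    apply/unitarymxP; rewrite trmxC_mul mulmxA -(mulmxA _ B) trmxC_diag.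
    rewrite mul_mx_diag; apply/matrixP => i j; rewrite mul_diag_mx !mxE.
    have [<-|ne_ij] := eqVneq i j; last first.
      by have := orthB i j ne_ij; rewrite mxE => ->; rewrite mulr0 mul0r.
    have := mul_trmxCE B B i i; rewrite mxE hs_row => ->.
    have := s_gt0 i; rewrite mxE => si0.
    rewrite geC0_conj ?invr_ge0 ?(ltW si0) // mulrAC -expr2 exprVn sqrtCK.
    by rewrite mulVf // gt_eqF // -sqrtC_gt0.
  exists s; rewrite mulmxA mulmx_diag.
  rewrite (_ : diag_mx _ = 1%:M) ?mul1mx // -diag_const_mx; congr diag_mx.
  by apply/rowP => i; rewrite !mxE mulfV // gt_eqF //; have := s_gt0 i; rewrite mxE.
(* A zero row keeps the rank of [B] below [n <= m], so some nonzero [v] is orthogonal to every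
   row. *)
have rkB : (\rank (B^t*) < m)%N.
  rewrite mxrank_map mxrank_tr (leq_trans _ le_nm) // ltn_neqAle rank_leq_row andbT.
  apply: contraTN isT => /row_freeP [B' BB'1].
  have /rowP/(_ i) := congr1 (row i) BB'1.
  rewrite row_mul (eqP Bi0) mul0mx !mxE eqxx => /eqP.
  by rewrite eq_sym oner_eq0.
pose v := nz_row (kermx (B^t*)).
have v0 : v != 0.
  by rewrite nz_row_eq0 -mxrank_eq0 mxrank_ker subn_eq0 -ltnNge.
have vB : v *m B^t* = 0 by apply/sub_kermxP/nz_row_sub.
pose B' := \matrix_k (if k == i then v else row k B).
have rowB' l : row l B' = if l == i then v else row l B by rewrite rowK.
have vBl l : (v *m (row l B)^t*) 0 0 = 0.
  by have /rowP/(_ l) := vB; rewrite mul_trmxCE row_id => ->; rewrite mxE.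
have [||Y uY [s B's]] := IHk B'.
- apply: leq_trans ltBk; apply: proper_card; apply/properP; split.
    apply/subsetP => l; rewrite !inE rowB'; case: (eqVneq l i) => // _.
    by rewrite (negbTE v0).
  by exists i => //; rewrite !inE rowB' eqxx.
- move=> j l ne_jl; rewrite mul_trmxCE !rowB'.
  case: (eqVneq j i) => [ji|ji]; case: (eqVneq l i) => [li|li] //.
  + by rewrite ji li eqxx in ne_jl.
  + have := congr1 Num.conj (vBl j); rewrite conjC0 => <-.
    have -> : row j B *m v^t* = (v *m (row j B)^t*)^t* by rewrite trmxC_mul trmxCK.
    by rewrite !mxE.
  + by rewrite -mul_trmxCE orthB.
exists Y => //; exists (\row_l if l == i then 0 else s 0 l).
apply/row_matrixP => l; rewrite row_mul row_diag_mx mxE -scalemxAl -rowE.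
case: eqP => [->|/eqP nli]; first by rewrite (eqP Bi0) scale0r.
have := rowB' l; rewrite (negbTE nli) => <-.
by rewrite B's row_mul row_diag_mx -scalemxAl -rowE.
Qed.

(** If the unitary [X] diagonalizes [A *m A^t*], then the rows of [X *m A] are pairwise
    orthogonal. *)
Lemma singular_value_decomposition n m (A : 'M[C]_(n, m)) : (n <= m)%N ->
  exists (X : 'M[C]_n) (Y : 'M[C]_(n, m)) (s : 'rV_n),
    [/\ X \is unitarymx, Y \is unitarymx & X *m A = diag_mx s *m Y].
Proof.
move=> le_nm; have [|X [d [uX AE]]] := @hermitian_spectral C n (A *m A^t*).
  by rewrite trmxC_mul trmxCK.
have [|Y uY [s XA]] := @orthogonal_rows_complete _ _ (X *m A) le_nm; last first.
  by exists X, Y, s.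
move=> i j ne_ij; rewrite trmxC_mul mulmxA -(mulmxA X) AE !mulmxA.
rewrite (unitarymxP uX) mul1mx -mulmxA (unitarymxP uX) mulmx1.
by rewrite mxE (negbTE ne_ij) mulr0n.
Qed.

Definition partial_unitarymx n m (M : 'M[C]_(n, m)) : Prop :=
  ((n <= m)%N -> M \is unitarymx) /\ ((m <= n)%N -> M^t* \is unitarymx).

Lemma exists_phase (z : C) : exists2 e : C, `|e| = 1 & e * z = `|z|.
Proof.
have [->|z0] := eqVneq z 0; first by exists 1; rewrite ?normr1 // mulr0 normr0.
exists (z^* / `|z|); first by rewrite normrM norm_conjC normfV normr_id mulfV ?normr_eq0.
by rewrite mulrAC -normCKC expr2 mulfK ?normr_eq0.
Qed.

(** In singular coordinates the trace is a sum of [s 0 i * M i i] with [s 0 i] in the unit disc.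
    Replacing each [s 0 i] by the phase that turns [M i i] into its modulus can only increase the
    absolute value. *)
Lemma contraction_rounding_wide n m (A : 'M[C]_(n, m)) (B : 'M_(m, n)) :
  (n <= m)%N -> contraction A ->
  exists2 U : 'M[C]_(n, m), U \is unitarymx & `|\tr (A *m B)| <= `|\tr (U *m B)|.
Proof.
move=> le_nm cA; have [X [Y [s [uX uY XA]]]] := singular_value_decomposition A le_nm.
have AE : A = X^t* *m (diag_mx s *m Y) by rewrite -XA mulmxA unitarymxPV // mul1mx.
pose M := Y *m B *m X^t*.
have trE (t : 'rV_n) : \tr (X^t* *m (diag_mx t *m Y) *m B) = \sum_i t 0 i * M i i.
  rewrite -mulmxA mxtrace_mulC -!mulmxA (mulmxA Y) -/M.
  by rewrite mul_diag_mx; apply: eq_bigr => i _; rewrite mxE.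
(* The square of this modulus is the squared length of row [i] of [X *m A], the image of a unit
   vector under a contraction. *)
have s_le1 i : `|s 0 i| <= 1.
  rewrite -(@expr_le1 _ 2) //.
  have -> : `|s 0 i| ^+ 2 = hs (row i (X *m A)).
    rewrite XA -hs_row -mul_trmxCE trmxC_mul mulmxA mulmxtVK //.
    by rewrite trmxC_diag mul_diag_mx !mxE eqxx mulr1n normCK.
  rewrite row_mul -hs_trmxC trmxC_mul; apply: le_trans (contraction_trmxC cA _) _.
  rewrite hs_trmxC -hs_row -mul_trmxCE (unitarymxP uX) mxE eqxx.
  exact: lexx.
have [e e1 eM] := fin_all_exists2 (fun i => exists_phase (M i i)).
exists (X^t* *m (diag_mx (\row_i e i) *m Y)).
  apply/unitarymxP; rewrite !trmxC_mul trmxCK !mulmxA mulmxtVK //.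
  rewrite trmxC_diag -!mulmxA (mulmxA (diag_mx _)) mulmx_diag.
  rewrite (_ : diag_mx _ = 1%:M) ?mul1mx ?unitarymxPV // -diag_const_mx.
  by congr diag_mx; apply/rowP => i; rewrite !mxE -normCK e1 expr1n.
rewrite AE !trE (le_trans (ler_norm_sum _ _ _)) //.
under [X in `|X|]eq_bigr do rewrite mxE eM.
rewrite ger0_norm ?sumr_ge0 //; apply: ler_sum => i _.
by rewrite normrM ler_piMl.
Qed.

(** The tall case is the wide case for the adjoints, since passing to adjoints conjugates the
    trace. *)
Lemma contraction_rounding n m (A : 'M[C]_(n, m)) (B : 'M_(m, n)) :
  contraction A ->
  exists2 U : 'M[C]_(n, m), partial_unitarymx U & `|\tr (A *m B)| <= `|\tr (U *m B)|.
Proof.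
have square p q (U : 'M[C]_(p, q)) : p = q -> U \is unitarymx -> U^t* \is unitarymx.
  by move=> epq; case: q / epq U => U; rewrite trmxC_unitary.
have [le_nm|/ltnW le_mn] := leqP n m => cA.
  have [U uU leU] := contraction_rounding_wide B le_nm cA; exists U => //.
  by split=> // le_mn; apply: square => //; apply/eqP; rewrite eqn_leq le_nm.
have [U uU leU] := contraction_rounding_wide (B^t*) le_mn (contraction_trmxC cA).
exists (U^t*); first split.
- by move=> le_nm; apply: square => //; apply/eqP; rewrite eqn_leq le_mn.
- by rewrite trmxCK.
have trC (M : 'M[C]_(n, m)) : `|\tr (M *m B)| = `|\tr (M^t* *m B^t*)|.
  by rewrite -norm_conjC -mxtraceC trmxC_mul mxtrace_mulC.
by rewrite !trC trmxCK.
Qed.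

End SingularValues.

(** * Sums over the quadruples that define the U^2 norm *)

Lemma sum_quads (V : nmodType) (G : finGroupType) (F : G * G * G * G -> V) :
  \sum_(q in quads G) F q =
  \sum_a \sum_b \sum_c F (a, b, c, a * b^-1 * c)%g.
Proof.
rewrite pair_big pair_big /=.
rewrite (eq_bigr (fun p : G * G * G =>
  \sum_(d | (p, d) \in quads G) F (p, d))) => [|[[a b] c] _].
  rewrite (pair_big_dep predT (fun p d => (p, d) \in quads G) (fun p d => F (p, d))).
  by apply: eq_big => [[p d]|[p d] _].
rewrite (big_pred1 (a * b^-1 * c)%g) // => d.
by rewrite inE -eq_mulgV1 eq_sym.
Qed.

Lemma card_quads (G : finGroupType) : #|quads G| = (#|G| ^ 3)%N.
Proof.
rewrite -sum1_card sum_quads !sum_nat_const muln1.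
by rewrite !expnS expn0 muln1.
Qed.

(** For each fixed [y], the map from (x, w, z) to the first three quotients is a bijection, and
    these determine the fourth; so every quadruple arises once per [y]. *)
Lemma sum_quotients (V : nmodType) (G : finGroupType) (F : G * G * G * G -> V) :
  \sum_x \sum_w \sum_y \sum_z
    F (x * y^-1, w * y^-1, w * z^-1, x * z^-1)%g =
  (\sum_(q in quads G) F q) *+ #|G|.
Proof.
rewrite sum_quads -sumr_const.
under eq_bigr do rewrite exchange_big.
rewrite exchange_big; apply: eq_bigr => y _.
rewrite (reindex_inj (mulIg y)); apply: eq_bigr => a _.
rewrite (reindex_inj (mulIg y)); apply: eq_bigr => b _.
rewrite (reindex_inj (inj_comp (mulIg (b * y)%g) invg_inj)).
by apply: eq_bigr => c _; rewrite /= !invMg !invgK !mulgA !mulgK mulgV mul1g.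
Qed.

(** * Vector-valued functions on the group and right translations *)

Section Blocks.

Variables (C : numClosedFieldType) (G : finGroupType) (n : nat).
Let N := #|{: G * 'I_n}|.

(* A function G -> C^n is a vector indexed by G * 'I_n; [block x] evaluates it at x. *)
Definition block (x : G) : 'M[C]_(n, N) :=
  \matrix_(i, a) (enum_val a == (x, i))%:R.

Lemma block_mul x y : block x *m (block y)^t* = (x == y)%:R%:M.
Proof.
apply/matrixP => i j; rewrite !mxE (bigD1 (enum_rank (x, i))) //= big1 => [|a].
  by rewrite !mxE enum_rankK eqxx mul1r addr0 xpair_eqE rmorph_nat; do 2 case: eqP.
rewrite -(inj_eq enum_val_inj) enum_rankK => /negbTE ne.
by rewrite !mxE ne mul0r.
Qed.

Lemma block_sum : \sum_x (block x)^t* *m block x = 1%:M.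
Proof.
apply/matrixP => a b; rewrite summxE.
under eq_bigr do rewrite mxE.
rewrite pair_big /= (bigD1 (enum_val a)) //= big1 => [|[x i] /negbTE ne].
  rewrite !mxE addr0 rmorph_nat -surjective_pairing eqxx mul1r.
  by rewrite (inj_eq enum_val_inj) eq_sym.
by rewrite !mxE eq_sym ne rmorph_nat mul0r.
Qed.

Lemma block_inj p (A A' : 'M[C]_(N, p)) :
  (forall x, block x *m A = block x *m A') -> A = A'.
Proof.
move=> eqA; rewrite -(mul1mx A) -(mul1mx A') -block_sum !mulmx_suml.
by apply: eq_bigr => x _; rewrite -!mulmxA eqA.
Qed.

Lemma hs_block p (A : 'M[C]_(N, p)) : hs A = \sum_x hs (block x *m A).
Proof.
rewrite [LHS]/hs mxtrace_mulC -[X in A^t* *m X]mul1mx -block_sum.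
rewrite mulmx_suml mulmx_sumr raddf_sum; apply: eq_bigr => x _ /=.
by rewrite /hs [RHS]mxtrace_mulC trmxC_mul !mulmxA.
Qed.

Lemma hs_block2 (A : 'M[C]_N) :
  hs A = \sum_x \sum_y hs (block x *m A *m (block y)^t*).
Proof.
rewrite hs_block; apply: eq_bigr => x _.
rewrite -hs_trmxC hs_block; apply: eq_bigr => y _.
by rewrite -hs_trmxC trmxC_mul trmxCK.
Qed.

Definition stack p (F : G -> 'M[C]_(n, p)) : 'M[C]_(N, p) :=
  \sum_x (block x)^t* *m F x.

Lemma block_stack p (F : G -> 'M[C]_(n, p)) x : block x *m stack F = F x.
Proof.
rewrite /stack mulmx_sumr (bigD1 x) //= big1 => [|y ne_yx].
  by rewrite mulmxA block_mul eqxx mul1mx addr0.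
by rewrite mulmxA block_mul eq_sym (negbTE ne_yx) mul_scalar_mx scale0r.
Qed.

Definition translation (g : G) : 'M[C]_N := stack (fun x => block (x * g)%g).

Lemma block_translation x g : block x *m translation g = block (x * g)%g.
Proof. exact: block_stack. Qed.

Lemma translation1 : translation 1 = 1%:M.
Proof.
by apply: block_inj => x; rewrite block_translation mulg1 mulmx1.
Qed.

Lemma translationM g h : translation (g * h)%g = translation g *m translation h.
Proof.
by apply: block_inj => x; rewrite mulmxA !block_translation mulgA.
Qed.

Lemma translation_trmxC g : (translation g)^t* = translation g^-1.
Proof.
rewrite /translation /stack trmxC_sum (reindex_inj (mulIg g^-1%g)) /=.
by apply: eq_bigr => x _; rewrite trmxC_mul trmxCK mulgKV.
Qed.

(** * The convolution operator and its norms *)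

Section Convolution.

Variable f : G -> 'M[C]_n.
Local Notation card := (#|G|%:R : C).

Definition convolution : 'M[C]_N :=
  stack (fun x => card^-1 *: \sum_y f (x * y^-1)%g *m block y).
Local Notation T := convolution.

Lemma card_gt0 : 0 < card.
Proof. by rewrite ltr0n -cardsT cardG_gt0. Qed.

Lemma convolution_translation g : T *m translation g = translation g *m T.
Proof.
apply: block_inj => x; rewrite !mulmxA block_translation !block_stack.
rewrite -scalemxAl mulmx_suml [in RHS](reindex_inj (mulIg g)); congr (_ *: _).
apply: eq_bigr => y _; rewrite -mulmxA block_translation.
by rewrite invMg !mulgA mulgK.
Qed.

Lemma block_convolution_block x y :
  block x *m T *m (block y)^t* = card^-1 *: f (x * y^-1)%g.
Proof.
rewrite block_stack -scalemxAl mulmx_suml (bigD1 y) //= big1 => [|z /negbTE ne].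
  by rewrite -mulmxA block_mul eqxx mulmx1 addr0.
by rewrite -mulmxA block_mul ne mul_mx_scalar scale0r.
Qed.

Lemma block_convolutionC_block x y :
  block x *m T^t* *m (block y)^t* = card^-1 *: (f (y * x^-1)%g)^t*.
Proof.
have -> : block x *m T^t* *m (block y)^t* = (block y *m T *m (block x)^t*)^t*.
  by rewrite !trmxC_mul trmxCK mulmxA.
by rewrite block_convolution_block trmxCZ fmorphV rmorph_nat.
Qed.

Lemma block_convolutionC x :
  block x *m T^t* = card^-1 *: \sum_y (f (y * x^-1)%g)^t* *m block y.
Proof.
rewrite -[LHS]mulmx1 -block_sum mulmx_sumr scaler_sumr.
by apply: eq_bigr => y _; rewrite mulmxA block_convolutionC_block scalemxAl.
Qed.

(** The operators [T^t* *m T] and [T *m T^t*] have the same norm, and the blocks of the latter are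
    sums of products f(x y^-1) f(w y^-1)^*. Squaring gives a sum over (x, w, y, z) with factor
    |G|^-4; the multiplicity |G| of each quadruple leaves |G|^-3. *)
Lemma hs_convolutionCM : hs (T^t* *m T) =
  card^-1 ^+ 3 * \sum_(q in quads G)
    let: (x, y, z, w) := q in
    \tr (f x *m (f y)^t* *m f z *m (f w)^t*).
Proof.
have -> : hs (T^t* *m T) = hs (T *m T^t*).
  by rewrite /hs !trmxC_mul !trmxCK !mulmxA mxtrace_mulC !mulmxA.
set F := (X in _ * \sum_(q in _) X q).
have TT x w : block x *m (T *m T^t*) *m (block w)^t* =
    card^-1 ^+ 2 *: \sum_y f (x * y^-1)%g *m (f (w * y^-1)%g)^t*.
  rewrite mulmxA -[block x *m T]mulmx1 -block_sum mulmx_sumr !mulmx_suml.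
  rewrite scaler_sumr; apply: eq_bigr => y _.
  rewrite mulmxA block_convolution_block -!mulmxA (mulmxA (block y)).
  by rewrite block_convolutionC_block -scalemxAl -scalemxAr scalerA expr2.
have card0 : card != 0 by rewrite gt_eqF ?card_gt0.
transitivity (card^-1 ^+ 4 * \sum_x \sum_w \sum_y \sum_z
    F (x * y^-1, w * y^-1, w * z^-1, x * z^-1)%g).
  rewrite hs_block2 mulr_sumr; apply: eq_bigr => x _.
  rewrite mulr_sumr; apply: eq_bigr => w _.
  rewrite TT hsZ normrX normfV normr_nat -exprM; congr (_ * _).
  rewrite /hs trmxC_sum mulmx_suml raddf_sum; apply: eq_bigr => y _.
  rewrite mulmx_sumr raddf_sum; apply: eq_bigr => z _.
  by rewrite /F trmxC_mul trmxCK !mulmxA.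
rewrite sum_quotients -[X in _ * X]mulr_natl mulrA; congr (_ * _).
by rewrite exprSr mulfVK.
Qed.

Hypothesis cf : forall x, contraction (f x).

Lemma hs_convolution_le : hs T <= n%:R.
Proof.
have card0 := card_gt0.
have hsf x : hs (f x) <= n%:R.
  rewrite -[f x]mulmx1; apply: le_trans (contraction_hs _ (cf x)) _.
  by rewrite /hs trmxC1 mulmx1 mxtrace1.
rewrite hs_block2; apply: (@le_trans _ _ (\sum_(x : G) \sum_(y : G) card^-1 ^+ 2 * n%:R)).
  apply: ler_sum => x _; apply: ler_sum => y _.
  rewrite block_convolution_block hsZ normfV normr_nat.
  by rewrite ler_pM2l // exprn_gt0 // invr_gt0.
rewrite !sumr_const -mulrnA -[leLHS]mulr_natl natrM mulrA -expr2 -exprMn mulfV ?gt_eqF //.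
by rewrite expr1n mul1r.
Qed.

(** By Cauchy-Schwarz over [y], each of the |G| blocks of the image has squared length at most
    [hs v] divided by |G|. *)
Lemma contraction_convolution : contraction T.
Proof.
have card0 := card_gt0.
move=> v; rewrite hs_block.
apply: (@le_trans _ _ (\sum_(x : G) card^-1 * hs v)); last first.
  by rewrite sumr_const -[leLHS]mulr_natl mulVKf ?gt_eqF.
apply: ler_sum => x _; rewrite mulmxA block_stack -scalemxAl hsZ mulmx_suml.
rewrite normfV normr_nat expr2 -mulrA ler_pM2l ?invr_gt0 // ler_pdivrMl //.
apply: le_trans (hs_sum_le _) _; rewrite ler_pM2l // hs_block.
by apply: ler_sum => y _; rewrite -mulmxA; apply: cf.
Qed.

(** The vector has |G| blocks f(y^-1)^* xi / |G|. The spare factor |G| pays for the scaling by its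
    square root in the evaluation map [ev] below. *)
Lemma hs_convolution_column (xi : 'cV[C]_n) :
  card * hs ((block 1 *m T)^t* *m xi) <= hs xi.
Proof.
have card0 := card_gt0.
rewrite -ler_pdivlMl // hs_block.
apply: (@le_trans _ _ (\sum_(y : G) card^-1 ^+ 2 * hs xi)); last first.
  rewrite sumr_const -[leLHS]mulr_natl mulrA exprSr expr1 mulrA.
  by rewrite mulfV ?gt_eqF // mul1r.
apply: ler_sum => y _; rewrite trmxC_mul !mulmxA block_convolutionC_block.
rewrite -scalemxAl hsZ normfV normr_nat ler_pM2l ?exprn_gt0 ?invr_gt0 //.
exact: contraction_trmxC.
Qed.

End Convolution.
End Blocks.

(** * The representation carried by a sum of eigenspaces *)

Lemma spectral_representation (C : numClosedFieldType) (G : finGroupType)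
    (n : nat) (f : G -> 'M[C]_n) :
  (forall x, contraction (f x)) ->
  exists (N : nat) (d : 'I_N -> C),
  [/\ forall k, 0 <= d k <= 1,
      \sum_k d k <= n%:R,
      \sum_k d k ^+ 2 = (#|G|%:R)^-1 ^+ 3 * \sum_(q in quads G)
        let: (x, y, z, w) := q in \tr (f x *m (f y)^t* *m f z *m (f w)^t*) &
      forall K : {set 'I_N}, (forall k l, d k = d l -> k \in K -> l \in K) ->
      exists (U V : 'M[C]_(n, #|K|)) (P : mx_representation C [set: G] #|K|),
      [/\ contraction U, contraction V, forall x, P x \is unitarymx &
          (#|G|%:R)^-1 * \sum_x \tr (f x *m (V *m P x *m U^t*)^t*)
            = \sum_(k in K) d k ^+ 2]].
Proof.
move=> cf; pose T := convolution f.
have [H HT] : exists H, H = T^t* *m T by exists (T^t* *m T).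
have card0 := card_gt0 C G.
have hermH : H^t* = H by rewrite HT trmxC_mul trmxCK.
have [Q [D [uQ HE]]] := hermitian_spectral hermH.
pose d k := D 0 k.
have QH : Q *m H = diag_mx D *m Q.
  by rewrite HE !mulmxA (unitarymxP uQ) mul1mx.
(* An eigenvalue of [H] is the squared length of the image under [T] of a unit eigenvector; hence it
   lies in [0, 1]. *)
have dE k : d k = hs (T *m (row k Q)^t*).
  rewrite -hs_trmxC trmxC_mul trmxCK -hs_row -row_mul -mul_trmxCE trmxC_mul trmxCK.
  rewrite mulmxA -(mulmxA Q) -HT QH -mulmxA (unitarymxP uQ) mulmx1 mxE eqxx.
  by rewrite mulr1n.
have d_ge0 k : 0 <= d k by rewrite dE hs_ge0.
have hsH : hs H = \sum_k d k ^+ 2.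
  have -> : hs H = hs (diag_mx D).
    rewrite /hs HE !trmxC_mul trmxCK !mulmxA mulmxtVK // -!mulmxA mxtrace_mulC.
    by rewrite !mulmxA mulmxtVK.
  rewrite /hs trmxC_diag mulmx_diag mxtrace_diag; apply: eq_bigr => k _.
  by rewrite !mxE -/(d k) geC0_conj // expr2.
exists #|{: G * 'I_n}|, d; split.
- move=> k; rewrite d_ge0 dE; apply: le_trans (contraction_convolution cf _) _.
  by rewrite hs_trmxC -hs_row -mul_trmxCE (unitarymxP uQ) mxE eqxx lexx.
- rewrite -mxtrace_diag; have -> : \tr (diag_mx D) = hs T; last exact: hs_convolution_le.
  rewrite /hs mxtrace_mulC -HT HE mxtrace_mulC mulmxA (unitarymxP uQ).
  by rewrite mul1mx.
- by rewrite -hsH HT hs_convolutionCM.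
move=> K closedK.
pose R := @translation C G n; pose B := @block C G n.
(* The columns of [Z^t*] form an orthonormal basis of W, and [Z^t* *m Z] is the orthogonal
   projection onto W. *)
pose Z : 'M[C]_(#|K|, _) := \matrix_i row (enum_val i) Q.
pose DK : 'rV[C]_#|K| := \row_i d (enum_val i).
have rowZ i : row i Z = row (enum_val i) Q by rewrite rowK.
have uZ : Z \is unitarymx.
  apply/unitarymxP/matrixP => i j.
  rewrite mul_trmxCE !rowZ -mul_trmxCE (unitarymxP uQ) !mxE.
  by rewrite (inj_eq enum_val_inj).
have ZZ := unitarymxP uZ.
pose I_K : 'rV[C]_#|{: G * 'I_n}| := \row_k (k \in K)%:R.
have ZP : Z^t* *m Z = Q^t* *m diag_mx I_K *m Q.
  apply/matrixP => a b; rewrite -mulmxA mul_diag_mx !mxE.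
  rewrite (bigID (mem K)) /= [X in _ + X]big1 ?addr0 => [|k /negbTE kK].
    rewrite [RHS](eq_bigr (fun k => (Q^t*) a k * Q k b)) => [|k kK].
      by rewrite [RHS]big_enum_val; apply: eq_bigr => i _; rewrite !mxE.
    by rewrite !mxE kK mul1r.
  by rewrite !mxE kK mul0r mulr0.
have ZH : Z *m H = diag_mx DK *m Z.
  apply/row_matrixP => i; rewrite [LHS]row_mul rowZ -[LHS]row_mul QH !row_mul.
  by rewrite !row_diag_mx -!scalemxAl -!rowE rowZ mxE.
have HZ : H *m Z^t* = Z^t* *m diag_mx DK.
  rewrite -[in LHS]hermH -trmxC_mul ZH trmxC_mul trmxC_diag.
  by congr (_ *m diag_mx _); apply/rowP => i; rewrite !mxE geC0_conj ?d_ge0.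
have TR g : T *m R g = R g *m T by apply: convolution_translation.
have HR g : H *m R g = R g *m H.
  rewrite HT -mulmxA TR !mulmxA; congr (_ *m _).
  apply: (can_inj (@trmxCK _ _ _)).
  by rewrite !trmxC_mul trmxCK translation_trmxC TR.
(* The projection onto W commutes with translations: in the eigenbasis, [R g] has no entry between
   distinct eigenvalues, and [K] contains all or none of the indices of each eigenvalue. *)
have ZR g : Z^t* *m Z *m R g = R g *m (Z^t* *m Z).
  have [A AE] : exists A, A = Q *m R g *m Q^t* by exists (Q *m R g *m Q^t*).
  have AD : A *m diag_mx D = diag_mx D *m A.
    rewrite AE !mulmxA -QH -!mulmxA (mulmxA H) HR -!mulmxA HE -!mulmxA.
    by rewrite (unitarymxP uQ) mulmx1.
  have AI : A *m diag_mx I_K = diag_mx I_K *m A.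
    apply/matrixP => k l; have /matrixP/(_ k l) := AD.
    rewrite !mul_mx_diag !mul_diag_mx [LHS]mxE [RHS]mxE => AD_kl.
    rewrite [LHS]mxE [RHS]mxE [I_K 0 l]mxE [I_K 0 k]mxE.
    have [dkl|dkl] := eqVneq (d k) (d l).
      have -> : (l \in K) = (k \in K) by apply/idP/idP; apply: closedK.
      by rewrite mulrC.
    have -> : A k l = 0; last by rewrite mul0r mulr0.
    apply/eqP; move/eqP: AD_kl; rewrite mulrC -subr_eq0 -mulrBl mulf_eq0.
    by rewrite subr_eq0 eq_sym (negbTE dkl).
  have RE : R g = Q^t* *m A *m Q.
    by rewrite AE !mulmxA unitarymxPV // mul1mx -mulmxA unitarymxPV // mulmx1.
  rewrite ZP RE -!mulmxA !(mulmxA Q) (unitarymxP uQ) !mul1mx.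
  by rewrite (mulmxA A) AI !mulmxA.
(* The restriction of translation to W in the basis [Z]; [ZR] makes it multiplicative. *)
pose P g := Z *m R g *m Z^t*.
have P_repr : mx_repr [set: G] P.
  split=> [|x y _ _]; first by rewrite /P /R translation1 mulmx1.
  rewrite /P -!mulmxA (mulmxA (Z^t*)) (mulmxA _ (R y)) ZR -!mulmxA ZZ mulmx1.
  by rewrite /R translationM -!mulmxA.
have PC x : (P x)^t* = P x^-1%g.
  by rewrite /P !trmxC_mul trmxCK translation_trmxC mulmxA.
have uP x : P x \is unitarymx.
  apply/unitarymxP; rewrite PC; case: P_repr => P1 PM.
  by rewrite -PM ?inE // mulgV P1.
pose s : C := sqrtC #|G|%:R.
have s2 : `|s| ^+ 2 = #|G|%:R.
  by rewrite -normrX sqrtCK normr_nat.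
(* Evaluation at the identity of the basis functions after applying [A]. The factor [s], the square
   root of |G|, makes the basis orthonormal for the averaged inner product. *)
pose ev A := s *: (B 1%g *m A *m Z^t*).
have evP A x : (forall g, A *m R g = R g *m A) -> ev A *m P x = s *: (B x *m A *m Z^t*).
  move=> AR; rewrite /ev /P -scalemxAl; congr (_ *: _).
  rewrite -!mulmxA (mulmxA (Z^t*)) (mulmxA _ (R x)) ZR -!mulmxA ZZ mulmx1.
  by rewrite (mulmxA A) AR !mulmxA block_translation mul1g.
pose V := ev T; pose U := ev H.
have cZ : contraction Z.
  rewrite -[Z]trmxCK; apply/contraction_trmxC/contraction_isometry.
  by rewrite trmxCK.
have cV : contraction V.
  rewrite -[V]trmxCK; apply: contraction_trmxC => xi.
  rewrite /V /ev trmxCZ -scalemxAl hsZ norm_conjC s2 trmxC_mul trmxCK.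
  apply: le_trans (hs_convolution_column cf xi); rewrite ler_pM2l //.
  by rewrite -mulmxA; apply: cZ.
(* The convolution formula for [T^t*] at the identity, applied to [T] on W; it exhibits [U] as an
   average of contractions. *)
have UE : U = #|G|%:R^-1 *: \sum_x (f x)^t* *m (V *m P x).
  under eq_bigr do rewrite evP // -scalemxAr.
  rewrite -scaler_sumr scalerA mulrC -scalerA; congr (_ *: _).
  rewrite HT !mulmxA block_convolutionC -scalemxAl -scalemxAl; congr (_ *: _).
  rewrite -mulmxA mulmx_suml; apply: eq_bigr => x _.
  by rewrite invg1 mulg1 !mulmxA.
have UP x : U *m P x = s *: (B x *m H *m Z^t*) by apply: evP.
clearbody U V.
have cP x : contraction (P x) by apply: contraction_isometry; apply: unitarymxPV.
have cU : contraction U.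
  rewrite UE; apply: contraction_average => x.
  by do !apply: contractionM => //; apply: contraction_trmxC.
exists U, V, (MxRepresentation P_repr); split=> //=.
have -> : #|G|%:R^-1 * \sum_x \tr (f x *m (V *m P x *m U^t*)^t*) = hs U.
  rewrite /hs [X in U *m X^t*]UE trmxCZ fmorphV rmorph_nat -scalemxAr linearZ /=.
  congr (_ * _); rewrite trmxC_sum mulmx_sumr raddf_sum; apply: eq_bigr => x _ /=.
  rewrite [(V *m P x *m _)^t*]trmxC_mul trmxCK mxtrace_mulC.
  by rewrite [(_^t* *m (V *m P x))^t*]trmxC_mul trmxCK !mulmxA.
(* Since [P x] is unitary, all blocks of [H *m Z^t*] have the same norm as the block at the
   identity, so [hs U] is the norm of the whole. *)
have hsUP x : hs U = #|G|%:R * hs (B x *m (H *m Z^t*)).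
  have -> : hs U = hs (U *m P x).
    by rewrite /hs trmxC_mul mulmxA mulmxtVK.
  by rewrite UP hsZ s2 mulmxA.
have -> : hs U = hs (H *m Z^t*).
  apply: (mulfI (negbT (gt_eqF card0))).
  rewrite {1}mulr_natl -sumr_const (eq_bigr _ (fun x _ => hsUP x)) -mulr_sumr.
  by rewrite -hs_block.
rewrite HZ big_enum_val /hs trmxC_mul trmxCK trmxC_diag mxtrace_mulC !mulmxA.
rewrite mulmxtVK // mulmx_diag mxtrace_diag; apply: eq_bigr => i _.
by rewrite !mxE geC0_conj ?d_ge0 // expr2.
Qed.

(** * From the operator norm to contractions *)

Lemma hs_mulmx_le (C : numClosedFieldType) m n (A : 'M[C]_(m, n)) (v : 'cV_n) :
  hs (A *m v) <= n%:R * hs A * hs v.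
Proof.
have -> : A *m v = \sum_j v j 0 *: col j A.
  apply/matrixP => i k; rewrite (ord1 k) !mxE summxE.
  by apply: eq_bigr => j _; rewrite !mxE mulrC.
apply: le_trans (hs_sum_le _) _; rewrite card_ord -mulrA ler_wpM2l ?ler0n //.
rewrite (hs_col A) mulr_suml; apply: ler_sum => j _.
rewrite hsZ mulrC ler_wpM2l ?hs_ge0 // hsE (bigD1 j) //= big_ord1 lerDl.
by apply: sumr_ge0 => k _; rewrite big_ord1 exprn_ge0.
Qed.

Local Open Scope complex_scope.
Local Open Scope sesquilinear_scope.

Section OperatorNorm.

Variable R : realType.

Lemma vnorm_ge0 n (v : 'cV[R[i]]_n) : 0 <= vnorm v.
Proof. exact: sqrtr_ge0. Qed.

Lemma hs_vnorm n (v : 'cV[R[i]]_n) : hs v = (vnorm v ^+ 2)%:C.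
Proof.
rewrite sqr_sqrtr ?sumr_ge0 // => [|i _]; last by rewrite sqr_ge0.
rewrite hsE rmorph_sum; apply: eq_bigr => i _.
by rewrite big_ord1 rmorphXn.
Qed.

Lemma vnormZ n (a : R) (v : 'cV[R[i]]_n) : 0 <= a ->
  vnorm (a%:C *: v) = a * vnorm v.
Proof.
move=> a_ge0; apply/eqP; rewrite -(eqrXn2 (n := 2)) ?vnorm_ge0 ?mulr_ge0 ?vnorm_ge0 //.
apply/eqP/complexI; rewrite -hs_vnorm hsZ hs_vnorm exprMn [RHS]rmorphM.
congr (_ * _); rewrite rmorphXn ger0_norm ?ler0c //.
Qed.

(** A supremum bounds its set only when the set is bounded above; the crude estimate [hs_mulmx_le]
    supplies such a bound. *)
Lemma vnorm_le_opnorm n m (A : 'M[R[i]]_(n, m)) (v : 'cV_m) :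
  vnorm v <= 1 -> vnorm (A *m v) <= opnorm A.
Proof.
move=> v1; apply: sup_upper_bound; last by exists v.
split; first by exists (vnorm (A *m v)), v.
have [M hM] : exists M : R, m%:R * hs A = M%:C.
  apply: complex_realP; apply: ger0_real.
  by rewrite mulr_ge0 ?hs_ge0 ?ler0n.
have M_ge0 : 0 <= M by rewrite -ler0c -hM mulr_ge0 ?hs_ge0 ?ler0n.
exists (Num.sqrt M) => _ [w /= w1 <-].
rewrite -(ler_pXn2r (n := 2)) ?nnegrE ?vnorm_ge0 ?sqrtr_ge0 // (sqr_sqrtr M_ge0).
rewrite -lecR -hs_vnorm; apply: le_trans (hs_mulmx_le _ _) _.
rewrite hM hs_vnorm -rmorphM lecR ler_piMr //.
by rewrite expr_le1 ?vnorm_ge0.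
Qed.

Lemma opnorm_contraction n m (A : 'M[R[i]]_(n, m)) :
  opnorm A <= 1 -> contraction A.
Proof.
move=> A1 v; have [->|] := eqVneq v 0; first by rewrite mulmx0 /hs !mul0mx !mxtrace0.
rewrite -hs_gt0 hs_vnorm ltcR exprn_even_gt0 //= => v_neq0.
have v_gt0 : 0 < vnorm v by rewrite lt_def v_neq0 vnorm_ge0.
rewrite hs_vnorm lecR lerXn2r ?nnegrE ?vnorm_ge0 //.
have vV : 0 <= (vnorm v)^-1 by rewrite invr_ge0 vnorm_ge0.
have /(vnorm_le_opnorm A) : vnorm ((vnorm v)^-1%:C *: v) <= 1.
  by rewrite vnormZ // mulVf ?gt_eqF.
rewrite -scalemxAr vnormZ // => /le_trans /(_ A1).
by rewrite mulrC ler_pdivrMr // mul1r.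
Qed.

End OperatorNorm.

(** * Counting the eigenvalues that are at least c/2 *)

Lemma spectral_mass (R : realType) (N : nat) (r : 'I_N -> R) (c n : R)
    (K := [set k | c / 2 <= r k]%SET) (m : R := #|K|%:R) :
  0 < c -> 0 < n -> (forall k, 0 <= r k <= 1) ->
  \sum_k r k <= n -> c * n <= \sum_k r k ^+ 2 ->
  [/\ c * n / (2 - c) <= m, m <= (2 - c) * n / c &
      tau c ^+ 4 * m <= \sum_(k in K) r k ^+ 2].
Proof.
move=> c0 n0 r01 sum_r sum_r2.
have r2 k : r k ^+ 2 <= r k.
  by case/andP: (r01 k) => r0 r1; rewrite expr2 ler_piMl.
have c1 : c <= 1.
  rewrite -(ler_pM2r n0) mul1r; apply: le_trans sum_r2 (le_trans _ sum_r).
  exact: ler_sum.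
set S := \sum_(k in K) _.
have S_le_m : S <= m.
  rewrite /m -sum1_card natr_sum; apply: ler_sum => k _.
  by apply: le_trans (r2 k) _; case/andP: (r01 k).
(* The sum of r^2 - (c/2) r is at least cn/2. Terms outside [K] are at most 0, and those in [K] are
   at most (1 - c/2) r^2 because r^2 <= r. *)
have S_ge : c / 2 * n <= S * (1 - c / 2).
  apply: (@le_trans _ _ (\sum_k (r k ^+ 2 - c / 2 * r k))).
    rewrite sumrB -mulr_sumr.
    have : c / 2 * \sum_k r k <= c / 2 * n by rewrite ler_pM2l // divr_gt0.
    lra.
  rewrite (bigID (mem K)) /= mulr_suml.
  apply: (@le_trans _ _ (\sum_(k in K) (r k ^+ 2 - c / 2 * r k))).
    rewrite gerDl; apply: sumr_le0 => k; rewrite inE -ltNge => rk.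
    by case/andP: (r01 k) => r0 r1; nra.
  by apply: ler_sum => k _; have := r2 k; rewrite mulrBr mulr1; nra.
(* The quantity (1 + c/2) r - r^2 is nonnegative on [0, 1] and at least c/2 on [c/2, 1], where it
   exceeds c/2 by (r - c/2)(1 - r). *)
have m_le : c / 2 * m <= (1 - c / 2) * n.
  apply: (@le_trans _ _ (\sum_k ((1 + c / 2) * r k - r k ^+ 2))); last first.
    rewrite sumrB -mulr_sumr.
    have : (1 + c / 2) * \sum_k r k <= (1 + c / 2) * n by rewrite ler_pM2l //; lra.
    lra.
  rewrite (bigID (mem K)) /= mulrC /m mulr_natl -sumr_const.
  apply: (@le_trans _ _ (\sum_(k in K) ((1 + c / 2) * r k - r k ^+ 2))).
    apply: ler_sum => k; rewrite inE => rk.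
    by case/andP: (r01 k) => r0 r1; nra.
  rewrite lerDl; apply: sumr_ge0 => k _.
  by have := r2 k; case/andP: (r01 k) => r0 r1; nra.
have S_ge2 : (c / 2) ^+ 2 * m <= S.
  rewrite mulr_natr -sumr_const; apply: ler_sum => k; rewrite inE => rk.
  have /andP[r0 _] := r01 k.
  by rewrite lerXn2r ?nnegrE // divr_ge0 // ltW.
have c2 : 0 < 2 - c by lra.
have S_ge3 : c * n / (2 - c) <= S by rewrite ler_pdivrMr //; lra.
have m_le' : m <= (2 - c) * n / c by rewrite ler_pdivlMr //; lra.
have m0 : 0 <= m by rewrite ler0n.
split=> //; first exact: le_trans S_ge3 S_le_m.
(* If the square root is the maximum, [S_ge2] suffices. Otherwise, with b = (c/(2 - c))^2 <= 1, one
   has b^4 m <= b m, and the upper bound on m gives b m <= cn/(2 - c) <= S. *)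
rewrite /tau; case: (leP (Num.sqrt (c / 2)) _) => _; last first.
  have c20 : 0 <= c / 2 by rewrite divr_ge0 // ltW.
  by rewrite (exprM _ 2 2) sqr_sqrtr.
set b := (c / (2 - c)) ^+ 2.
have q0 : 0 <= c / (2 - c) by rewrite divr_ge0 // ltW.
have b0 : 0 <= b by rewrite exprn_ge0.
have b1 : b <= 1.
  by rewrite expr_le1 // ler_pdivrMr // mul1r; lra.
apply: (@le_trans _ _ (b * m)).
  by rewrite ler_wpM2r // exprS ler_piMr // exprn_ile1.
apply: le_trans S_ge3.
apply: (@le_trans _ _ (b * ((2 - c) * n / c))); first by rewrite ler_wpM2l.
rewrite /b le_eqVlt; apply/orP; left; apply/eqP; field.
by rewrite !gt_eqF.
Qed.

(** * Choice of the threshold and rounding of the two contractions *)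

Theorem theorem5p6 (R : realType) (G : finGroupType) (c : R) (hc : 0 < c)
    (n : nat) (hn : (0 < n)%N) (f : G -> 'M[R[i]]_n)
    (hf : forall x : G, opnorm (f x) <= 1)
    (hU2 : (c * n%:R)%:C <= U2norm f ^+ 4) :
  exists m : nat,
    c * n%:R / (2 - c) <= m%:R /\ m%:R <= (2 - c) * n%:R / c /\
    exists (U V : 'M[R[i]]_(n, m)) (P : mx_representation R[i] [set: G] m),
      partial_unitary U /\ partial_unitary V /\ unitary_repr P /\
      (tau c ^+ 4 * m%:R)%:C
        <= `| average [set: G] (fun x => mxinner (f x) (V *m P x *m U^t*)) |.
Proof.
have cf x : contraction (f x) by apply: opnorm_contraction.
have [N [d [d01 sum_d sum_d2 repr]]] := spectral_representation cf.
pose r k := complex.Re (d k).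
have dE k : d k = (r k)%:C.
  by rewrite RRe_real // ger0_real //; case/andP: (d01 k).
have U2E : U2norm f ^+ 4 = \sum_k d k ^+ 2.
  by rewrite /U2norm rootCK // /average card_quads natrX -exprVn sum_d2.
have [||||m_ge m_le mass] := @spectral_mass R N r c n%:R hc.
- by rewrite ltr0n.
- by move=> k; rewrite -ler0c -lecR -dE.
- rewrite -lecR rmorph_sum rmorph_nat; under eq_bigr do rewrite /= -dE.
  exact: sum_d.
- rewrite -lecR rmorph_sum (le_trans hU2) // U2E.
  by apply: ler_sum => k _; rewrite dE rmorphXn.
set K := [set k | _]%SET in m_ge m_le mass.
have [|U0 [V0 [P [cU cV uP eqF]]]] := repr K.
  by move=> k l; rewrite !inE !dE => /complexI ->.
exists #|K|; split=> //; split=> //.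
(* The form is linear in [U] and conjugate-linear in [V]; [FU] and [FV] express it, up to
   conjugation for [V], as a trace against a fixed matrix. *)
pose F (U V : 'M[R[i]]_(n, #|K|)) :=
  (#|G|%:R)^-1 * \sum_x \tr (f x *m (V *m P x *m U^t*)^t*).
have FU U V : F U V =
    \tr (U *m ((#|G|%:R)^-1 *: \sum_x (V *m P x)^t* *m f x)).
  rewrite -scalemxAr linearZ /=; congr (_ * _).
  rewrite mulmx_sumr raddf_sum; apply: eq_bigr => x _ /=.
  by rewrite trmxC_mul trmxCK mxtrace_mulC !mulmxA.
have FV U V : `|F U V| =
    `|\tr (V *m ((#|G|%:R)^-1 *: \sum_x P x *m U^t* *m (f x)^t*))|.
  rewrite -norm_conjC; congr `|_|; rewrite /F rmorphM fmorphV rmorph_nat.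
  rewrite -scalemxAr linearZ /=; congr (_ * _).
  rewrite rmorph_sum mulmx_sumr raddf_sum; apply: eq_bigr => x _ /=.
  by rewrite -mxtraceC trmxC_mul trmxCK !mulmxA.
have [U uU le1] := contraction_rounding
  ((#|G|%:R)^-1 *: \sum_x (V0 *m P x)^t* *m f x) cU.
(* The functional for [V] is built from the rounded [U], so that the two inequalities chain. *)
have [V uV le2] := contraction_rounding
  ((#|G|%:R)^-1 *: \sum_x P x *m U^t* *m (f x)^t*) cV.
exists U, V, P; split; first exact: uU.
split; first exact: uV.
split; first exact: uP.
have -> : average [set: G] (fun x => mxinner (f x) (V *m P x *m U^t*)) = F U V.
  rewrite /average cardsT; congr (_ * _).
  by apply: eq_bigl => x; rewrite inE.
have F0 : F U0 V0 = (\sum_(k in K) r k ^+ 2)%:C.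
  rewrite /F eqF rmorph_sum; apply: eq_bigr => k _.
  by rewrite dE rmorphXn.
rewrite -!FU in le1; rewrite -!FV in le2.
apply: le_trans (le_trans le1 le2); rewrite F0 ger0_norm; first by rewrite lecR.
by rewrite ler0c sumr_ge0 // => k _; rewrite sqr_ge0.
Qed.
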